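(* Let $n\ge1$, let $\mathfrak G$ be a finite set of $n$-qubit Clifford gates, and let $G$ be the pattern transfer graph of $\mathfrak G$. Identify a vector $\mathbf v=(v_{a,\mathcal G})\in\mathbb R^{|\mathfrak G|\cdot 4^n}$ both with an element of the edge space $C_1(G)$ and with the linear function $f_{\mathbf v}(\mathbf l)=\sum_{a\in\mathsf P^n,\,\mathcal G\in\mathfrak G}v_{a,\mathcal G}\,l_a^{\mathcal G}$ of the logarithmic Pauli fidelities $l_a^{\mathcal G}=\log\lambda_a^{\mathcal G}$. Let $F_L$ be the set of those $\mathbf v$ for which $f_{\mathbf v}$ is a learnable function of the noise model. Then $F_L$ equals the cycle space $Z(G)$; that is, $f_{\mathbf v}$ is learnable if and only if $\mathbf v\in Z(G)$. Consequently the orthogonal complement of $F_L$ in the edge space (the unlearnable information) is the cut space $U(G)$, and the number of unlearnable degrees of freedom is $$|\mathfrak G|\cdot 4^n-\dim F_L = 2^n-c,$$ where $c$ is the number of (weakly) connected components of $G$.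
   Context: **Paulis and patterns.** $\mathsf P^n$ is the $n$-qubit Pauli group modulo its center; its $4^n$ elements are represented by the tensor products $P_a\in\{I,X,Y,Z\}^{\otimes n}$, and $P_a$ and its label $a$ are used interchangeably. The pattern $\mathrm{pt}(P_a)\in\{0,1\}^n$ has $j$-th bit $0$ if the $j$-th tensor factor of $P_a$ is $I$, and $1$ otherwise. For a Clifford unitary $G$ we write $\mathcal G(\cdot)=G(\cdot)G^\dagger$; then $\mathcal G(P_a)$ is a Pauli operator up to a sign $\pm1$, and the sign is ignored when taking $\mathrm{pt}$. **Pauli channels.** An $n$-qubit Pauli channel is a map $\Lambda(\cdot)=\sum_{a\in\mathsf P^n}p_aP_a(\cdot)P_a$ with $p_a\ge 0$, $\sum_a p_a=1$; the $p_a$ are its Pauli error rates. It satisfies $\Lambda(P_b)=\lambda_bP_b$ with Pauli fidelities $\lambda_b=\sum_a(-1)^{\langle a,b\rangle}p_a$, where $\langle a,b\rangle=0$ if $P_a,P_b$ commute and $1$ otherwise. **Noise models.** A noise model $\mathcal N=\{\mathcal E^S,\mathcal E^M,(\Lambda_{\mathcal G})_{\mathcal G\in\mathfrak G}\}$ for $\mathfrak G$ consists of $n$-qubit Pauli channels: $\mathcal E^S$ (state preparation noise), $\mathcal E^M$ (measurement noise) and, for each $\mathcal G\in\mathfrak G$, a gate noise channel $\Lambda_{\mathcal G}$ with Pauli fidelities $\lambda_a^{\mathcal G}$. All Pauli fidelities and all Pauli error rates of all these channels are required to be strictly positive. **Experiments.** An experiment consists of an $n$-qubit state $\rho_0$,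 a POVM $\{E_o\}_o$, and a finite sequence of operations, each of which is either a tensor product $\bigotimes_{j=1}^n\mathcal U_j$ of arbitrary single-qubit unitary channels or a gate $\mathcal G\in\mathfrak G$. Under the noise model $\mathcal N$, single-qubit unitaries are implemented perfectly, each gate $\mathcal G$ is replaced by $\widetilde{\mathcal G}=\mathcal G\circ\Lambda_{\mathcal G}$, the initial state becomes $\mathcal E^S(\rho_0)$, and $\mathcal E^M$ is applied immediately before the measurement. The outcome distribution is $p_{\mathcal N}(o)=\mathrm{Tr}\big(E_o\,(\mathcal E^M\circ\widetilde{\mathcal C}\circ\mathcal E^S)(\rho_0)\big)$, where $\widetilde{\mathcal C}$ is the composition of the noisy operations. **Learnability.** Two noise models $\mathcal N_1,\mathcal N_2$ are indistinguishable if $p_{\mathcal N_1}=p_{\mathcal N_2}$ for every experiment, and distinguishable otherwise. A function $f$ of noise models is learnable if for all noise models $\mathcal N_1,\mathcal N_2$, $f(\mathcal N_1)\ne f(\mathcal N_2)$ implies that $\mathcal N_1,\mathcal N_2$ are distinguishable. **Pattern transfer graph.** The directed multigraph $G$ (loops and parallel edges allowed) with vertex set $\{0,1\}^n$ and, for each $P_a\in\mathsf P^n$ and $\mathcal G\in\mathfrak G$, one edge $e_{a,\mathcal G}$ from $\mathrm{pt}(P_a)$ to $\mathrm{pt}(\mathcal G(P_a))$; it has $|\mathfrak G|\cdot4^n$ edges. The edge space is $C_1(G)=\mathbb R^{E(G)}\cong\mathbb R^{|\mathfrak G|\cdot 4^n}$ with the standard inner product. **Cycle space.** A chain is an alternating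 sequence $(v_0,e_1,v_1,\dots,e_q,v_q)$ of vertices and edges in which each $e_k$ is an edge from $v_{k-1}$ to $v_k$ (then called oriented) or from $v_k$ to $v_{k-1}$; a loop counts as oriented. A simple cycle is a closed chain ($v_0=v_q$) containing no edge twice. To a simple cycle $z$ associate $\mathbf v_z\in C_1(G)$ with $\mathbf v_z(e)=+1$ if $e\in z$ is oriented, $-1$ if $e\in z$ is not oriented, $0$ if $e\notin z$. The cycle space $Z(G)$ is the span of all $\mathbf v_z$. **Cut space.** For a partition $V=V_1\cup V_2$ of the vertices with at least one edge between $V_1$ and $V_2$, the cut vector $\mathbf v_p\in C_1(G)$ takes value $+1$ on edges from $V_1$ to $V_2$, $-1$ on edges from $V_2$ to $V_1$, and $0$ on all other edges. The cut space $U(G)$ is the span of all cut vectors. A weakly connected component is a maximal subgraph in which any two vertices are joined by an undirected path. *)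

(* Defs.v *)
(* MathComp, with [R : realType] and [ln] from MathComp-Analysis and the complex
   numbers [R[i]] from mathcomp-real-closed. *)
From HB Require Import structures.
From mathcomp Require Import all_boot all_order all_algebra.
From mathcomp Require Import complex.
From mathcomp Require Import reals exp.

Set Implicit Arguments.
Unset Strict Implicit.
Unset Printing Implicit Defensive.

Import Order.TTheory GRing.Theory Num.Theory.
Local Open Scope ring_scope.
Local Open Scope complex_scope.
Local Open Scope sesquilinear_scope.

Inductive pauli1 := PI | PX | PY | PZ.

Definition pauli1_code (s : pauli1) : bool * bool :=
  match s with
  | PI => (false, false) | PX => (true, false)
  | PY => (true, true) | PZ => (false, true)
  end.
Definition pauli1_decode (c : bool * bool) : pauli1 :=
  match c with
  | (false, false) => PI | (true, false) => PX
  | (true, true) => PY | (false, true) => PZ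
  end.
Lemma pauli1_codeK : cancel pauli1_code pauli1_decode.
Proof. by case. Qed.
HB.instance Definition _ := Finite.copy pauli1 (can_type pauli1_codeK).

(* An element of the n-qubit Pauli group modulo its center is identified with
   the tuple of tensor factors of its representative in {I,X,Y,Z}^(x)n. *)
Notation pauli n := {ffun 'I_n -> pauli1}.
Notation pattern n := {ffun 'I_n -> bool}.

Definition pt n (a : pauli n) : pattern n := [ffun j => a j != PI].

(* The computational basis of (C^2)^(x)n is labelled by functions 'I_n -> 'I_2;
   there are 2^n of them, and [basis_label] turns a matrix index into a label. *)
Notation qdim n := #|{ffun 'I_n -> 'I_2}|.
Definition basis_label n (i : 'I_(qdim n)) : {ffun 'I_n -> 'I_2} := enum_val i.
Notation op R n := 'M[R[i]]_(qdim n).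

Section Operators.
Context (R : realType).

Definition mx2 (a b c d : R[i]) : 'M[R[i]]_2 :=
  \matrix_(i, j) if i == 0 then (if j == 0 then a else b)
                 else (if j == 0 then c else d).

Definition pauli1_mx (s : pauli1) : 'M[R[i]]_2 :=
  match s with
  | PI => mx2 1 0
              0 1
  | PX => mx2 0 1
              1 0
  | PY => mx2 0 (- 'i)
              'i 0
  | PZ => mx2 1 0
              0 (-1)
  end.

Definition tensor n (A : 'I_n -> 'M[R[i]]_2) : op R n :=
  \matrix_(i, j) \prod_(k < n) A k (basis_label i k) (basis_label j k).

Definition pauli_mx n (a : pauli n) : op R n := tensor (fun k => pauli1_mx (a k)).

Definition anticomm n (a b : pauli n) : bool :=
  ~~ comm_mxb (pauli_mx a) (pauli_mx b).

Definition unitary_channel n (U A : op R n) : op R n := U *m A *m U ^t*.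

(* Unitaries that conjugate the Pauli group { i^k P_a } into itself. *)
Definition clifford n (U : op R n) : Prop :=
  U \is unitarymx /\
  forall a : pauli n, exists (b : pauli n) (k : nat),
    unitary_channel U (pauli_mx a) = 'i ^+ k *: pauli_mx b.

(* The label b with U P_a U^* = +P_b or -P_b; it exists and is unique when U is
   Clifford, the default value a being irrelevant. *)
Definition clifford_act n (U : op R n) (a : pauli n) : pauli n :=
  odflt a [pick b : pauli n | (unitary_channel U (pauli_mx a) == pauli_mx b)
                           || (unitary_channel U (pauli_mx a) == - pauli_mx b)].

(* [0 <= z] in R[i] means that z is real and nonnegative, so this includes
   Hermiticity. *)
Definition psd n (A : op R n) : Prop :=
  forall x : 'cV[R[i]]_(qdim n), 0 <= (x ^t* *m A *m x) 0 0.

Definition density n (rho : op R n) : Prop := psd rho /\ \tr rho = 1.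

Definition povm n (O : finType) (E : O -> op R n) : Prop :=
  (forall o, psd (E o)) /\ \sum_o E o = 1%:M.

Record pauli_channel n := PauliChannel {
  rate : pauli n -> R;
  rate_ge0 : forall a, 0 <= rate a;
  rate_sum1 : \sum_a rate a = 1
}.

Definition channel_map n (L : pauli_channel n) (A : op R n) : op R n :=
  \sum_a (rate L a)%:C *: (pauli_mx a *m A *m pauli_mx a).

Definition fidelity n (L : pauli_channel n) (b : pauli n) : R :=
  \sum_a (-1) ^+ anticomm a b * rate L a.

Definition positive_channel n (L : pauli_channel n) : Prop :=
  (forall a, 0 < rate L a) /\ (forall b, 0 < fidelity L b).

End Operators.

Section Learnability.
Context (R : realType) (n : nat) (gate : finType).

Record noise_model := NoiseModel {
  prep_noise : pauli_channel R n;
  meas_noise : pauli_channel R n;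
  gate_noise : gate -> pauli_channel R n;
  prep_noise_pos : positive_channel prep_noise;
  meas_noise_pos : positive_channel meas_noise;
  gate_noise_pos : forall g, positive_channel (gate_noise g)
}.

Inductive operation :=
| Local1 (V : 'I_n -> 'M[R[i]]_2) of (forall j, V j \is unitarymx)
| Gate of gate.

(* The head of [circuit] is applied first. *)
Record experiment := Experiment {
  init_state : op R n;
  init_stateP : density init_state;
  outcome : finType;
  effect : outcome -> op R n;
  effectP : povm effect;
  circuit : seq operation
}.

Context (U : gate -> op R n).

Definition noisy_operation (N : noise_model) (x : operation) (A : op R n) :
    op R n :=
  match x with
  | Local1 V _ => unitary_channel (tensor V) A
  | Gate g => unitary_channel (U g) (channel_map (gate_noise N g) A)
  end.

Definition noisy_circuit (N : noise_model) (s : seq operation) (A : op R n) :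
    op R n :=
  foldl (fun B x => noisy_operation N x B) A s.

(* This complex number is a probability, hence real. *)
Definition outcome_prob (N : noise_model) (e : experiment) (o : outcome e) :
    R[i] :=
  \tr (effect o *m
       channel_map (meas_noise N)
         (noisy_circuit N (circuit e)
            (channel_map (prep_noise N) (init_state e)))).

Definition indistinguishable (N1 N2 : noise_model) : Prop :=
  forall (e : experiment) (o : outcome e), outcome_prob N1 o = outcome_prob N2 o.

Definition distinguishable (N1 N2 : noise_model) : Prop :=
  ~ indistinguishable N1 N2.

Definition learnable (T : Type) (f : noise_model -> T) : Prop :=
  forall N1 N2, f N1 <> f N2 -> distinguishable N1 N2.

End Learnability.

Record multigraph := Multigraph {
  vertex : finType;
  edge : finType;
  source : edge -> vertex;
  target : edge -> vertex
}.

(* [R^o] is R as a vector space over itself. *)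
Notation edge_space R G := {ffun edge G -> R^o}.

Section Graphs.
Context (R : realType) (G : multigraph).

Definition dot (u v : edge_space R G) : R := \sum_e u e * v e.

Definition in_span (S : edge_space R G -> Prop) (v : edge_space R G) : Prop :=
  exists2 s : seq (edge_space R G), (forall w, w \in s -> S w) & v \in <<s>>%VS.

(* A closed chain (v_0, e_1, v_1, ..., e_q, v_q) is given by the cyclic sequence
   of its steps (v_(k-1), e_k, v_k). *)
Definition step := (vertex G * edge G * vertex G)%type.
Definition step_from (s : step) := s.1.1.
Definition step_edge (s : step) := s.1.2.
Definition step_to (s : step) := s.2.

Definition forward_step (e : edge G) : step := (source e, e, target e).
Definition backward_step (e : edge G) : step := (target e, e, source e).

Definition valid_step (s : step) : bool :=
  (s == forward_step (step_edge s)) || (s == backward_step (step_edge s)).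

Definition simple_cycle (z : seq step) : bool :=
  [&& all valid_step z,
      cycle [rel s t | step_to s == step_from t] z
    & uniq (map step_edge z)].

(* The forward test comes first, so that a loop counts as oriented. *)
Definition cycle_vector (z : seq step) : edge_space R G :=
  [ffun e => if forward_step e \in z then 1
             else if backward_step e \in z then -1 else 0].

Definition cycle_space : edge_space R G -> Prop :=
  in_span (fun v => exists2 z, simple_cycle z & v = cycle_vector z).

(* The partition is V = A u (~: A). *)
Definition crosses (A : {set vertex G}) : bool :=
  [exists e, (source e \in A) != (target e \in A)].

Definition cut_vector (A : {set vertex G}) : edge_space R G :=
  [ffun e => if (source e \in A) && (target e \notin A) then 1
             else if (source e \notin A) && (target e \in A) then -1 else 0].

Definition cut_space : edge_space R G -> Prop :=
  in_span (fun v => exists2 A, crosses A & v = cut_vector A).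

Definition adjacent : rel (vertex G) :=
  [rel u v | [exists e, ((source e == u) && (target e == v))
                     || ((source e == v) && (target e == u))]].

Definition nb_components : nat := n_comp adjacent (vertex G).

End Graphs.

Section PatternTransfer.
Context (R : realType) (n : nat) (gate : finType) (U : gate -> op R n).

Definition pattern_transfer_graph : multigraph :=
  @Multigraph (pattern n) (pauli n * gate)%type
    (fun e => pt e.1) (fun e => pt (clifford_act (U e.2) e.1)).

Definition log_fidelity (N : noise_model R n gate) (a : pauli n) (g : gate) : R :=
  ln (fidelity (gate_noise N g) a).

Definition log_functional (v : edge_space R pattern_transfer_graph)
    (N : noise_model R n gate) : R :=
  \sum_(a : pauli n) \sum_(g : gate) v (a, g) * log_fidelity N a g.

End PatternTransfer.

(* Main.v *)
(* Log fidelities are learnable only up to a gauge.  Let D multiply P_a by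
   exp (phi (pt a)).  Local unitaries preserve the span of the Paulis of a given
   pattern, hence commute with D, so replacing E^S, Lambda_g and E^M by D E^S,
   (g^-1 D g) Lambda_g D^-1 and E^M D^-1 changes no outcome distribution, while
   it adds the coboundary phi (pt (g a)) - phi (pt a) to the log fidelities.
   Damping all nontrivial fidelities by a small common factor makes both models
   positive.  Conversely, write s and m for the differences between the log
   fidelities of the preparation and measurement noise of two indistinguishable
   models.  Preparing P_b, rotating it locally to a P_b' of the same pattern and
   measuring P_b' gives s b + m b' = 0, so s depends on the pattern only;
   preparing P_a, applying g and measuring P_(g a) then shows that the gate log
   fidelities differ by the coboundary of s.  So f_v is learnable exactly when v
   is orthogonal to all coboundaries.  These form the cut space, of dimension
   |V| - c, and their orthogonal complement is the cycle space. *)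
From HB Require Import structures.
From mathcomp Require Import all_boot all_order all_algebra.
From mathcomp Require Import complex ring lra.
From mathcomp Require Import reals sequences exp.
Require Import Defs.

Set Implicit Arguments.
Unset Strict Implicit.
Unset Printing Implicit Defensive.

Import Order.TTheory GRing.Theory Num.Theory.
Local Open Scope ring_scope.
Local Open Scope complex_scope.
Local Open Scope sesquilinear_scope.

(** * Cycles and cuts of a multigraph *)

Section Span.
Context (R : realType) (G : multigraph) (S : edge_space R G -> Prop).

Lemma in_span_mem v : S v -> in_span S v.
Proof.
move=> Sv; exists [:: v]; last by rewrite memv_span ?mem_head.
by move=> w; rewrite inE => /eqP->.
Qed.

Lemma in_span0 : in_span S 0.
Proof. by exists [::]; rewrite ?mem0v. Qed.

Lemma in_spanD u v : in_span S u -> in_span S v -> in_span S (u + v).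
Proof.
move=> [s Ss us] [t St vt]; exists (s ++ t).
  by move=> w; rewrite mem_cat => /orP[/Ss|/St].
by rewrite span_cat memv_add.
Qed.

Lemma in_spanZ a v : in_span S v -> in_span S (a *: v).
Proof. by move=> [s Ss vs]; exists s; rewrite ?memvZ. Qed.

Lemma in_span_sum (I : finType) (F : I -> edge_space R G) :
  (forall i, in_span S (F i)) -> in_span S (\sum_i F i).
Proof.
by move=> SF; elim/big_ind: _ => //; [exact: in_span0 | exact: in_spanD].
Qed.

Lemma in_span_sub (W : {vspace edge_space R G}) v :
  (forall w, S w -> w \in W) -> in_span S v -> v \in W.
Proof.
by move=> SW [s Ss]; apply/subvP/span_subvP => w /Ss/SW.
Qed.

End Span.

(** * Boundary, coboundary and the dimension count *)

Section Homology.
Context (R : realType) (G : multigraph).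
Local Notation vertex_space := {ffun vertex G -> R^o}.
Implicit Types (f : vertex_space) (u v : edge_space R G).

Definition coboundary_fun f : edge_space R G :=
  [ffun e => f (target e) - f (source e)].

Definition boundary_fun v : vertex_space :=
  [ffun x => \sum_(e | target e == x) v e - \sum_(e | source e == x) v e].

Fact coboundary_is_linear : linear coboundary_fun.
Proof.
move=> a f h; apply/ffunP => e; rewrite !ffunE /=.
by rewrite scalerBr addrACA opprD.
Qed.
HB.instance Definition _ :=
  GRing.isLinear.Build R vertex_space (edge_space R G) _ coboundary_fun
    coboundary_is_linear.

Fact boundary_is_linear : linear boundary_fun.
Proof.
move=> a u v; apply/ffunP => x; rewrite !ffunE /= scalerBr !scaler_sumr.
rewrite addrACA -opprD -!big_split /=.
by congr (_ - _); apply: eq_bigr => e _; rewrite !ffunE.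
Qed.
HB.instance Definition _ :=
  GRing.isLinear.Build R (edge_space R G) vertex_space _ boundary_fun
    boundary_is_linear.

Definition coboundary : 'Hom(vertex_space, edge_space R G) :=
  linfun coboundary_fun.
Definition boundary : 'Hom(edge_space R G, vertex_space) :=
  linfun boundary_fun.

Lemma coboundaryE f e : coboundary f e = f (target e) - f (source e).
Proof. by rewrite lfunE /= ffunE. Qed.

(** Summation by parts: the edges are grouped once by target and once by source. *)
Lemma boundary_adjoint v f :
  dot v (coboundary f) = \sum_x boundary v x * f x.
Proof.
have fiber (h : edge G -> vertex G) :
    \sum_e v e * f (h e) = \sum_x (\sum_(e | h e == x) v e) * f x.
  rewrite (partition_big h xpredT) //=; apply: eq_bigr => x _.
  by rewrite mulr_suml; apply: eq_bigr => e /eqP->.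
rewrite /dot; under eq_bigr do rewrite coboundaryE mulrBr.
rewrite sumrB !fiber -sumrB; apply: eq_bigr => x _.
by rewrite lfunE /= ffunE mulrBl.
Qed.

Lemma sum_sqr_eq0 (I : finType) (f : {ffun I -> R^o}) :
  \sum_i f i * f i = 0 :> R -> f = 0.
Proof.
move=> f0; apply/ffunP => i; rewrite ffunE; apply/eqP.
rewrite -sqrf_eq0 expr2; move/eqP: f0; rewrite psumr_eq0 => [/allP f0|j _].
  by apply: f0; rewrite mem_index_enum.
by rewrite -expr2 sqr_ge0.
Qed.

Lemma mem_ker_boundary v :
  v \in lker boundary <-> forall f, dot v (coboundary f) = 0.
Proof.
rewrite memv_ker; split=> [/eqP bv0 f|v0].
  by rewrite boundary_adjoint bv0 big1 // => x _; rewrite ffunE mul0r.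
(* Testing against [f := boundary v] turns the pairing into a sum of squares. *)
by apply/eqP/sum_sqr_eq0; rewrite -boundary_adjoint v0.
Qed.

Lemma path_step_sum f (s : step G) p :
  path [rel s t | step_to s == step_from t] s p ->
  \sum_(t <- s :: p) (f (step_to t) - f (step_from t)) =
    f (step_to (last s p)) - f (step_from s).
Proof.
elim: p s => [|t p IHp] s /=; first by rewrite big_seq1.
case/andP=> /eqP st /IHp; rewrite big_cons => ->.
by rewrite st [LHS]addrC addrA addrNK.
Qed.

Lemma cycle_step_sum f (z : seq (step G)) :
  cycle [rel s t | step_to s == step_from t] z ->
  \sum_(t <- z) (f (step_to t) - f (step_from t)) = 0.
Proof.
case: z => [|s p] /=; first by rewrite big_nil.
rewrite rcons_path => /andP[/path_step_sum-> /eqP->].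
by rewrite subrr.
Qed.

Lemma uniq_map_inj_in (T1 T2 : eqType) (h : T1 -> T2) (s : seq T1) :
  uniq (map h s) -> {in s &, injective h}.
Proof.
elim: s => //= x s IHs /andP[xs /IHs inj] y1 y2; rewrite !inE.
case/predU1P=> [->|y1s] /predU1P[->|y2s] //.
- by move=> xy; case/negP: xs; rewrite xy map_f.
- by move=> xy; case/negP: xs; rewrite -xy map_f.
- exact: inj.
Qed.

(** Paired with a coboundary, the cycle vector gives the sum of the increments of [f] around the
    cycle, which telescopes to 0. *)
Lemma simple_cycle_ker (z : seq (step G)) :
  simple_cycle z -> cycle_vector R z \in lker boundary.
Proof.
case/and3P=> /allP zvalid zcycle zuniq; apply/mem_ker_boundary => f.
have inj := uniq_map_inj_in zuniq.
rewrite -[RHS](cycle_step_sum f zcycle).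
rewrite /dot (bigID (mem (map (@step_edge G) z))) /= [X in _ + X]big1 => [|e ez].
  rewrite addr0 -big_uniq // big_map [LHS]big_seq [RHS]big_seq.
  apply: eq_bigr => s sz; rewrite coboundaryE ffunE.
  (* Edges do not repeat, so a forward step in [z] on the edge of [s] is [s] itself. Otherwise [s]
     runs backward, and coefficient and increment both change sign. *)
  case: ifPn => [fz|fz].
    by rewrite mul1r -[in RHS](inj _ _ fz sz erefl).
  have /orP[/eqP sE|/eqP sE] := zvalid _ sz; first by rewrite -sE sz in fz.
  by rewrite -sE sz mulN1r opprB [in RHS]sE.
have notin (s : step G) : step_edge s = e -> s \notin z.
  by move=> se; apply: contra ez => sz; rewrite -se map_f.
by rewrite ffunE !ifN ?mul0r // notin.
Qed.

Definition adjacent_on (Q : pred (edge G)) : rel (vertex G) :=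
  [rel x y | [exists e, Q e && (((source e == x) && (target e == y))
                               || ((source e == y) && (target e == x)))]].

(** Distinct vertices force distinct edges. The last clause speaks of an arbitrary step [s] arriving
    at [x], which serves the induction and also lets a closing edge be put in front. *)
Lemma simple_path_steps (Q : pred (edge G)) (x : vertex G) p :
  path (adjacent_on Q) x p -> uniq (x :: p) ->
  exists z : seq (step G),
    [/\ all (@valid_step G) z,
        forall s, s \in z ->
          [/\ Q (step_edge s), step_from s \in x :: p & step_to s \in x :: p],
        uniq (map (@step_edge G) z)
      & forall s, step_to s = x ->
          path [rel s t | step_to s == step_from t] s z
          /\ step_to (last s z) = last x p].
Proof.
elim: p x => [|y p IHp] x /=; first by exists [::].
case/andP=> /existsP[e /andP[Qe ends]] yp /andP[xNp yuniq].
have [z [zvalid zon zuniq zpath]] := IHp y yp yuniq.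
exists ((x, e, y) :: z); split=> /=.
- rewrite zvalid andbT /valid_step /forward_step /backward_step /step_edge /=.
  by case/orP: ends => /andP[/eqP-> /eqP->]; rewrite eqxx ?orbT.
- move=> s; rewrite inE => /predU1P[->|/zon[Qs sf st]].
    by rewrite /step_from /step_to /= !inE !eqxx /= orbT.
  by rewrite inE sf inE st !orbT.
(* The edge [e] has the endpoint [x], while all later steps run between vertices of [y :: p], which
   avoids [x]. *)
- rewrite zuniq andbT; apply/mapP => -[s sz es].
  have [_ sf st] := zon s sz; have /orP sv := allP zvalid s sz.
  case/negP: xNp; move: sf st; rewrite -es in sv.
  by case: sv => /eqP->; rewrite /step_from /step_to /=;
     case/orP: ends => /andP[/eqP-> /eqP->].
- by move=> s sx; have [zp zl] := zpath (x, e, y) erefl; rewrite sx eqxx.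
Qed.

(** Induction on the size of the support. An edge [e] of the support lies on a cycle within the
    support; subtracting [v e] times its cycle vector removes [e] and adds no edge. A loop is closed
    by the empty path. *)
Lemma ker_boundary_cycle v : v \in lker boundary -> cycle_space v.
Proof.
have [m] := ubnP #|[set e | v e != 0]|; elim: m v => // m IHm v.
rewrite ltnS => vm vker.
have [v0|] := set_0Vmem [set e | v e != 0].
  suff -> : v = 0 by exact: in_span0.
  apply/ffunP => e; rewrite ffunE.
  by move/setP/(_ e): v0; rewrite !inE => /negbFE/eqP.
case=> e; rewrite inE => ve0.
pose Q e' := (e' != e) && (v e' != 0).
have [/connectP[p]|disconnected] :=
    boolP (connect (adjacent_on Q) (target e) (source e)).
  case/shortenP=> q qpath quniq _ qlast.
  have [z [zvalid zon zuniq zpath]] := simple_path_steps qpath quniq.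
  have [zp zl] := zpath (forward_step e) erefl.
  have zcycle : simple_cycle (forward_step e :: z).
    apply/and3P; split=> /=.
    - by rewrite zvalid andbT /valid_step eqxx.
    - by rewrite rcons_path zp /= zl -qlast eqxx.
    - rewrite zuniq andbT; apply/mapP=> -[s /zon[/andP[/negP sNe _] _ _] es].
      by apply: sNe; rewrite -es.
  set w := cycle_vector R (forward_step e :: z).
  have we : w e = 1 by rewrite ffunE mem_head.
  have w0 e' : v e' = 0 -> w e' = 0.
    move=> ve'0; have e'Ne : e' != e by apply: contraNneq ve0 => <-; apply/eqP.
    have notin (s : step G) : step_edge s = e' -> s \notin forward_step e :: z.
      move=> se; rewrite inE negb_or; apply/andP; split.
        by apply: contraNneq e'Ne => sE; rewrite -se sE.
      by apply/negP => /zon[]; rewrite /Q se ve'0 eqxx andbF.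
    by rewrite ffunE !ifN // notin.
  rewrite -(subrK (v e *: w) v); apply: in_spanD; last first.
    by apply/in_spanZ/in_span_mem; exists (forward_step e :: z).
  apply: IHm; last by rewrite memvB ?memvZ ?simple_cycle_ker.
  have v'E e' : (v - v e *: w) e' = v e' - v e * w e' by rewrite !ffunE.
  apply: leq_trans vm; apply: proper_card; apply/properP; split.
    apply/subsetP => e'; rewrite !inE v'E; apply: contra => /eqP ve'0.
    by rewrite w0 // ve'0 mulr0 subr0.
  by exists e; rewrite !inE // v'E we negbK mulr1 subrr.
(* If no cycle through [e] exists, [f] is the indicator of what [target e] reaches without [e]. In
   the support of [v] only [e] leaves this set, so orthogonality to the coboundary of [f] forces
   [v e = 0]. *)
pose f : vertex_space :=
  [ffun x => (connect (adjacent_on Q) (target e) x)%:R].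
have Qsym : connect_sym (adjacent_on Q).
  apply: sym_connect_sym => x y; apply: eq_existsb => e'.
  by rewrite orbC.
case/eqP: ve0; have /mem_ker_boundary/(_ f) := vker.
rewrite /dot (bigD1 e) //= coboundaryE !ffunE connect0 (negPf disconnected).
rewrite subr0 mulr1 big1 ?addr0 // => e' e'Ne.
have [->|ve'0] := eqVneq (v e') 0; first by rewrite mul0r.
rewrite coboundaryE !ffunE (same_connect_r Qsym (y := source e')).
  by rewrite subrr mulr0.
rewrite connect1 //; apply/existsP; exists e'.
by rewrite /Q e'Ne ve'0 !eqxx orbT.
Qed.

Lemma cycle_spaceE v : cycle_space v <-> v \in lker boundary.
Proof.
split; last exact: ker_boundary_cycle.
by apply: in_span_sub => w [z /simple_cycle_ker zker ->].
Qed.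

Lemma cut_vectorE (A : {set vertex G}) :
  cut_vector R A = coboundary [ffun x => (x \notin A)%:R].
Proof.
apply/ffunP => e; rewrite coboundaryE !ffunE.
by case: (source e \in A); case: (target e \in A) => /=;
  rewrite ?subrr ?subr0 ?sub0r.
Qed.

Lemma cut_spaceE u : cut_space u <-> u \in limg coboundary.
Proof.
split=> [|/memv_imgP[f _ ->]].
  apply: in_span_sub => w [A _ ->].
  by rewrite cut_vectorE memv_img ?memvf.
(* Vertex indicators, written as complements to match [cut_vectorE], reduce the claim to cuts around
   a single vertex. *)
have -> : f = \sum_x f x *: [ffun y => (y \notin ~: [set x])%:R].
  apply/ffunP => y; rewrite sum_ffunE (bigD1 y) //= big1 => [|x xNy].
    by rewrite addr0 !ffunE !inE eqxx /GRing.scale /= mulr1.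
  by rewrite !ffunE !inE negbK eq_sym (negPf xNy) scaler0.
rewrite linear_sum; apply: in_span_sum => x; rewrite linearZ /=.
apply: in_spanZ; rewrite -cut_vectorE.
have [cr|ncr] := boolP (crosses (~: [set x])).
  by apply: in_span_mem; exists (~: [set x]).
(* A partition crossed by no edge is not a generator, but its vector is 0. *)
suff -> : cut_vector R (~: [set x]) = 0 by exact: in_span0.
apply/ffunP => e; rewrite !ffunE.
move: ncr; rewrite negb_exists => /forallP/(_ e).
by rewrite negbK => /eqP->; case: (target e \in _).
Qed.

Lemma ker_boundary_cap : (lker boundary :&: limg coboundary = 0)%VS.
Proof.
apply/eqP; rewrite -subv0; apply/subvP => v; rewrite memv_cap memv0.
case/andP=> /mem_ker_boundary v0 /memv_imgP[f _ vE].
by apply/eqP/sum_sqr_eq0; rewrite -/(dot v v) {2}vE.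
Qed.

Lemma ker_coboundary_cap : (lker coboundary :&: limg boundary = 0)%VS.
Proof.
apply/eqP; rewrite -subv0; apply/subvP => f; rewrite memv_cap memv0 memv_ker.
case/andP=> /eqP f0 /memv_imgP[v _ fE].
apply/eqP/sum_sqr_eq0; rewrite {1}fE -boundary_adjoint f0.
by rewrite /dot big1 // => e _; rewrite ffunE mulr0.
Qed.

Lemma dim_ffun (I : finType) : \dim {: {ffun I -> R^o}} = #|I|.
Proof. by rewrite dimvf /dim /= muln1. Qed.

(** The two trivial intersections bound both dimension sums from above; with rank-nullity for both
    maps this makes the ranks of boundary and coboundary equal. *)
Lemma dim_limg_coboundary :
  (\dim (lker boundary) + \dim (limg coboundary))%N = #|edge G|.
Proof.
have kb := limg_ker_dim boundary fullv.
have kc := limg_ker_dim coboundary fullv.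
rewrite !capfv in kb kc; rewrite dim_ffun in kb.
have leb : (\dim (lker boundary) + \dim (limg coboundary) <= #|edge G|)%N.
  by rewrite -dimv_sum_cap ker_boundary_cap dimv0 addn0 -dim_ffun dimvS ?subvf.
have lec : (\dim (lker coboundary) + \dim (limg boundary) <= #|vertex G|)%N.
  by rewrite -dimv_sum_cap ker_coboundary_cap dimv0 addn0 -dim_ffun dimvS ?subvf.
apply/eqP; rewrite eqn_leq leb /= -kb leq_add2l.
by rewrite -(leq_add2l (\dim (lker coboundary))) kc dim_ffun.
Qed.

Lemma orthogonal_ker_boundary u :
  (forall v, v \in lker boundary -> dot u v = 0) <-> cut_space u.
Proof.
have dotC a b : dot a b = dot b a :> R.
  by apply: eq_bigr => e _; rewrite mulrC.
rewrite cut_spaceE; split=> [u0|/memv_imgP[f _ ->] v /mem_ker_boundary v0].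
  have : u \in (lker boundary + limg coboundary)%VS.
    suff -> : (lker boundary + limg coboundary)%VS = fullv by exact: memvf.
    apply/eqP; rewrite eqEdim subvf /= dim_ffun -dim_limg_coboundary.
    by rewrite -dimv_sum_cap ker_boundary_cap dimv0 addn0 leqnn.
  (* The cycle part [k] of [u] is orthogonal to [u] and to [d], hence to itself. *)
  case/memv_addP=> k kk [d dd uE]; suff k0 : k = 0 by rewrite uE k0 add0r.
  apply: sum_sqr_eq0; rewrite -/(dot k k).
  have -> : dot k k = dot u k - dot d k.
    rewrite uE /dot -sumrB; apply: eq_bigr => e _.
    by rewrite ffunE mulrDl addrK.
  rewrite u0 // sub0r dotC; case/memv_imgP: dd => f _ ->.
  by rewrite (iffLR (mem_ker_boundary k) kk) oppr0.
by rewrite dotC v0.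
Qed.

Lemma adjacent_connect_sym : connect_sym (@adjacent G).
Proof.
by apply: sym_connect_sym => x y; apply: eq_existsb => e; rewrite orbC.
Qed.

Definition component_root x : {x | roots (@adjacent G) x} :=
  exist _ (fingraph.root (@adjacent G) x) (roots_root adjacent_connect_sym x).

(** One free value per component, spread constantly over it. *)
Definition extend_roots_fun (f : {ffun {x | roots (@adjacent G) x} -> R^o}) :
    vertex_space :=
  [ffun x => f (component_root x)].

Fact extend_roots_is_linear : linear extend_roots_fun.
Proof. by move=> a f h; apply/ffunP => x; rewrite !ffunE. Qed.
HB.instance Definition _ :=
  GRing.isLinear.Build R _ vertex_space _ extend_roots_fun
    extend_roots_is_linear.

(** A potential has zero coboundary exactly when it is constant on components, so extension from the
    roots is an isomorphism onto this kernel. *)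
Lemma dim_ker_coboundary : \dim (lker coboundary) = nb_components G.
Proof.
pose ext := linfun extend_roots_fun.
have ext_inj : (lker ext == 0)%VS.
  apply/lker0P => f h /ffunP fh; apply/ffunP => -[x rx].
  have := fh x; rewrite !lfunE /= !ffunE.
  have -> // : component_root x = exist _ x rx.
  by apply: val_inj => /=; apply/eqP.
have <- : limg ext = lker coboundary.
  apply/eqP; rewrite eqEsubv; apply/andP; split; apply/subvP => f.
    case/memv_imgP=> h _ ->; rewrite memv_ker; apply/eqP/ffunP => e.
    rewrite coboundaryE !lfunE /= !ffunE.
    suff -> : component_root (target e) = component_root (source e).
      by rewrite subrr.
    apply: val_inj => /=; apply/eqP.
    rewrite root_connect; last exact: adjacent_connect_sym.
    by apply/connect1/existsP; exists e; rewrite !eqxx orbT.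
  rewrite memv_ker => /eqP/ffunP f0; apply/memv_imgP.
  exists [ffun r => f (val r)]; first exact: memvf.
  apply/ffunP => x; rewrite lfunE /= !ffunE /=.
  have /connectP[p] := connect_root (@adjacent G) x.
  move: (fingraph.root _ x) => r.
  elim: p x => [|y p IHp] x /=; first by move=> _ ->.
  case/andP=> /existsP[e ends] yp /(IHp _ yp)<-.
  have := f0 e; rewrite coboundaryE ffunE => /eqP; rewrite subr_eq0 => /eqP.
  by case/orP: ends => /andP[/eqP-> /eqP->].
rewrite limg_dim_eq ?(eqP ext_inj) ?capv0 // dim_ffun card_sig.
by apply: eq_card => x; rewrite !inE andbT.
Qed.

Lemma cyclomatic_number :
  (\dim (lker boundary) + #|vertex G|)%N = (#|edge G| + nb_components G)%N.
Proof.
rewrite -dim_limg_coboundary -dim_ker_coboundary.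
have := limg_ker_dim coboundary fullv; rewrite capfv dim_ffun => <-.
by rewrite -addnA (addnC (\dim (lker coboundary))).
Qed.

End Homology.

(** * Pauli operators *)

Lemma sum_pauli1 (V : nmodType) (F : pauli1 -> V) :
  \sum_s F s = F PI + F PX + F PY + F PZ.
Proof.
rewrite (reindex pauli1_decode) /=; last first.
  by exists pauli1_code => [[[] []]|[]].
transitivity (\sum_x \sum_y F (pauli1_decode (x, y))).
  by rewrite pair_bigA; apply: eq_bigr => -[].
rewrite !big_bool /= addrC [F PZ + _]addrC [F PY + _]addrC -!addrA.
by congr (_ + _); rewrite addrC -addrA.
Qed.

Definition anticomm1 (s t : pauli1) : bool := [&& s != PI, t != PI & s != t].

Section SingleQubit.
Context (R : realType).
Implicit Types (s t : pauli1).
Local Notation P := (@pauli1_mx R).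

Lemma ord2_cases (T : 'I_2 -> Prop) : T 0 -> T 1 -> forall i, T i.
Proof.
by move=> T0 T1 [[|[|//]] p];
  [rewrite (_ : Ordinal p = 0) | rewrite (_ : Ordinal p = 1)] => //; exact: val_inj.
Qed.

Lemma mx2_mul (a b c d a' b' c' d' : R[i]) :
  mx2 a b c d *m mx2 a' b' c' d' =
  mx2 (a * a' + b * c') (a * b' + b * d') (c * a' + d * c') (c * b' + d * d').
Proof.
apply/matrixP; elim/ord2_cases; elim/ord2_cases;
  by rewrite !mxE big_ord_recl big_ord1 !mxE.
Qed.

Lemma mx2_scale (x a b c d : R[i]) :
  x *: mx2 a b c d = mx2 (x * a) (x * b) (x * c) (x * d).
Proof. by apply/matrixP; elim/ord2_cases; elim/ord2_cases; rewrite !mxE. Qed.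

Lemma mx2_adj (a b c d : R[i]) : (mx2 a b c d)^t* = mx2 a^*%R c^*%R b^*%R d^*%R.
Proof. by apply/matrixP; elim/ord2_cases; elim/ord2_cases; rewrite !mxE. Qed.

Lemma mx2_tr (a b c d : R[i]) : \tr (mx2 a b c d) = a + d.
Proof. by rewrite /mxtrace big_ord_recl big_ord1 !mxE. Qed.

Lemma pauli1_mxI : P PI = 1%:M.
Proof. by apply/matrixP; elim/ord2_cases; elim/ord2_cases; rewrite !mxE. Qed.

(* The abstract [j] hides convertible but distinct forms of ['i] from [ring]. *)
Let Y_form : exists j : R[i],
  [/\ j * j = -1, j^*%R = - j & P PY = mx2 0 (- j) j 0].
Proof.
exists 'i; split=> //; first by rewrite -expr2 sqr_i.
by apply/eqP; rewrite eq_complex /= oppr0 !eqxx.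
Qed.

Lemma pauli1_mulC s t :
  P s *m P t = (-1) ^+ anticomm1 s t *: (P t *m P s).
Proof.
have [j [jj _ Y]] := Y_form.
by case: s; case: t; rewrite ?Y /= !mx2_mul mx2_scale; congr mx2; ring: jj.
Qed.

Lemma pauli1_sqr s : P s *m P s = 1%:M.
Proof.
have [j [jj _ Y]] := Y_form.
by rewrite -pauli1_mxI; case: s; rewrite ?Y /= !mx2_mul; congr mx2; ring: jj.
Qed.

Lemma pauli1_mxtrM s t : \tr (P s *m P t) = (2 * (s == t))%:R.
Proof.
have [j [jj _ Y]] := Y_form.
by case: s; case: t; rewrite ?Y /= !mx2_mul mx2_tr; ring: jj.
Qed.

Lemma pauli1_adj s : (P s)^t* = P s.
Proof.
have [j [_ jc Y]] := Y_form.
by case: s; rewrite ?Y /= mx2_adj ?rmorphN /= ?jc ?opprK conjC0 ?conjC1.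
Qed.

(** Entrywise form of the fact that the sum of [P s] tensor [P s] is twice the swap. *)
Lemma pauli1_complete (l k i j : 'I_2) :
  \sum_s P s l k * P s i j = (2 * ((l == j) && (k == i)))%:R.
Proof.
have [y [yy _ Y]] := Y_form.
rewrite sum_pauli1 Y; elim/ord2_cases: l; elim/ord2_cases: k;
by elim/ord2_cases: i; elim/ord2_cases: j; rewrite !mxE /=; ring: yy.
Qed.

(** Distinct nontrivial Paulis anticommute, so their sum divided by the square root of 2 is a
    Hermitian unitary exchanging them, as the Hadamard gate does for X and Z. *)
Lemma pauli1_rotation s t : (s != PI) = (t != PI) ->
  exists2 V : 'M[R[i]]_2, V \is unitarymx & V *m P s *m V^t* = P t.
Proof.
have [<- _|sNt st] := eqVneq s t.
  exists 1%:M; first by apply/unitarymxP; rewrite mul1mx trmx1 map_mx1.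
  by rewrite mul1mx trmx1 map_mx1 mulmx1.
have anti : anticomm1 s t.
  by move: sNt st; rewrite /anticomm1; case: s; case: t.
have PsPt : P s *m P t = - (P t *m P s) by rewrite pauli1_mulC anti scaleN1r.
pose c : R[i] := (Num.sqrt 2^-1)%:C.
have cc : c * c = 2^-1.
  by rewrite -rmorphM -expr2 sqr_sqrtr ?invr_ge0 ?ler0n // fmorphV rmorph_nat.
have cconj : c^*%R = c by rewrite /c; apply/eqP; rewrite eq_complex /= oppr0 !eqxx.
have half (M : 'M[R[i]]_2) : 2^-1 *: (M + M) = M.
  by rewrite -mulr2n -[M *+ 2]scaler_nat scalerA mulVf ?pnatr_eq0 // scale1r.
have adj : (c *: (P s + P t))^t* = c *: (P s + P t).
  by rewrite linearZ linearD /= map_mxZ map_mxD !pauli1_adj /= cconj.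
exists (c *: (P s + P t)); first apply/unitarymxP; rewrite adj.
  rewrite -scalemxAl -scalemxAr scalerA cc mulmxDl !mulmxDr !pauli1_sqr PsPt.
  by rewrite addrA addrNK half.
rewrite -!scalemxAl -scalemxAr scalerA cc !mulmxDl !mulmxDr !pauli1_sqr !mul1mx.
rewrite -!mulmxA pauli1_sqr mulmx1 PsPt mulmxN mulmxA pauli1_sqr mul1mx.
by rewrite addrC addrA addrNK half.
Qed.

End SingleQubit.

Lemma ffun_neq (I : finType) (T : eqType) (f g : {ffun I -> T}) :
  f != g -> exists i, f i != g i.
Proof.
move=> fNg; apply/existsP; apply: contraNT fNg; rewrite negb_exists.
by move=> /forallP fg; apply/eqP/ffunP => i; apply/eqP; have := fg i; rewrite negbK.
Qed.

(** * Tensor products of single-qubit matrices *)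

Section Tensor.
Context (R : realType) (n : nat).
Implicit Types (A B V : 'I_n -> 'M[R[i]]_2).

Lemma sum_basis (F : {ffun 'I_n -> 'I_2} -> R[i]) :
  \sum_(i < qdim n) F (basis_label i) = \sum_f F f.
Proof.
rewrite [RHS](reindex (@basis_label n)) //; apply: onW_bij.
exact: enum_val_bij.
Qed.

Lemma tensorM A B : tensor A *m tensor B = tensor (fun k => A k *m B k).
Proof.
apply/matrixP => i j; rewrite !mxE.
under [RHS]eq_bigr do rewrite mxE.
rewrite bigA_distr_bigA -sum_basis.
by apply: eq_bigr => l _; rewrite !mxE -big_split.
Qed.

Lemma tensor_tr A : \tr (tensor A) = \prod_k \tr (A k).
Proof.
rewrite /mxtrace bigA_distr_bigA; under eq_bigr do rewrite mxE.
by rewrite (sum_basis (fun f => \prod_k A k (f k) (f k))).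
Qed.

Lemma tensor_adj A : (tensor A)^t* = tensor (fun k => (A k)^t*).
Proof.
apply/matrixP => i j; rewrite !mxE rmorph_prod.
by apply: eq_bigr => k _; rewrite !mxE.
Qed.

Lemma tensor1 : tensor (fun=> 1%:M) = 1%:M :> op R n.
Proof.
apply/matrixP => i j; rewrite !mxE; have [<-|iNj] := eqVneq i j.
  by rewrite big1 // => k _; rewrite mxE eqxx.
have /ffun_neq[k ik] : basis_label i != basis_label j.
  by rewrite (inj_eq enum_val_inj).
by rewrite (bigD1 k) //= mxE (negPf ik) mul0r.
Qed.

Lemma eq_tensor A B : A =1 B -> tensor A = tensor B.
Proof.
by move=> AB; apply/matrixP=> i j; rewrite !mxE; under eq_bigr do rewrite AB.
Qed.

Lemma tensorZ (c : 'I_n -> R[i]) A :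
  tensor (fun k => c k *: A k) = (\prod_k c k) *: tensor A.
Proof.
apply/matrixP => i j; rewrite !mxE -big_split.
by apply: eq_bigr => k _; rewrite mxE.
Qed.

End Tensor.

(** * The Paulis as an orthogonal operator basis *)

Section PauliBasis.
Context (R : realType) (n : nat).
Implicit Types (a b c : pauli n) (A : op R n).
Local Notation P := (@pauli_mx R n).
Local Notation id_pauli := ([ffun=> PI] : pauli n).

Lemma pauli_mx_id : P id_pauli = 1%:M.
Proof.
by rewrite -tensor1; apply: eq_tensor => k; rewrite ffunE pauli1_mxI.
Qed.

Lemma pauli_adj a : (P a)^t* = P a.
Proof. by rewrite tensor_adj; apply: eq_tensor => k; rewrite pauli1_adj. Qed.

Lemma pauli_sqr a : P a *m P a = 1%:M.
Proof.
by rewrite tensorM -tensor1; apply: eq_tensor => k; rewrite pauli1_sqr.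
Qed.

Lemma pauli_mxtrM a b : \tr (P a *m P b) = (2 ^ n * (a == b))%:R.
Proof.
rewrite tensorM tensor_tr; under eq_bigr do rewrite pauli1_mxtrM.
have [<-|aNb] := eqVneq a b.
  under eq_bigr do rewrite eqxx.
  by rewrite prodr_const card_ord !muln1 natrX.
have [k ak] := ffun_neq aNb.
by rewrite (bigD1 k) //= (negPf ak) !muln0 mul0r.
Qed.

Lemma pauli_complete A : \sum_c \tr (P c *m A) *: P c = (2 ^ n)%:R *: A.
Proof.
apply/matrixP => i j; rewrite summxE mxE.
(* The single-qubit swap relation, multiplied over all qubits. *)
have entries l k : \sum_c P c l k * P c i j = (2 ^ n)%:R *+ ((l == j) && (k == i)).
  under eq_bigr do rewrite !mxE -big_split /=.
  rewrite -(bigA_distr_bigA (fun m s => pauli1_mx R s (basis_label l m)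
    (basis_label k m) * pauli1_mx R s (basis_label i m) (basis_label j m))).
  under eq_bigr do rewrite pauli1_complete.
  have [/andP[/eqP-> /eqP->]|ne] := boolP ((l == j) && (k == i)).
    under eq_bigr do rewrite !eqxx.
    by rewrite prodr_const card_ord muln1 natrX.
  have [m mne] : exists m, ~~ ((basis_label l m == basis_label j m)
                               && (basis_label k m == basis_label i m)).
    apply/existsP; apply: contraNT ne; rewrite negb_exists => /forallP eqs.
    by apply/andP; split; apply/eqP/enum_val_inj/ffunP => m; have := eqs m;
      rewrite negbK => /andP[/eqP ? /eqP ?].
  by rewrite (bigD1 m) //= (negPf mne) muln0 mul0r.
transitivity (\sum_l \sum_k A k l * \sum_c P c l k * P c i j).
  under eq_bigr do rewrite mxE /mxtrace mulr_suml.
  rewrite exchange_big; apply: eq_bigr => l _ /=.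
  under eq_bigr do rewrite mxE mulr_suml.
  rewrite exchange_big; apply: eq_bigr => k _ /=.
  by rewrite mulr_sumr; apply: eq_bigr => c _; rewrite mulrCA mulrA.
rewrite (bigD1 j) //= [X in _ + X]big1 => [|l lj]; last first.
  by apply: big1 => k _; rewrite entries (negPf lj) mulr0.
rewrite addr0 (bigD1 i) //= [X in _ + X]big1 => [|k ki]; last first.
  by rewrite entries (negPf ki) andbF mulr0.
by rewrite entries !eqxx addr0 mulrC.
Qed.

Lemma pow2_neq0 : (2 ^ n)%:R != 0 :> R[i].
Proof. by rewrite pnatr_eq0 -lt0n expn_gt0. Qed.

Lemma op1_neq0 : (1%:M : op R n) != 0.
Proof.
have := pow2_neq0; apply: contraNneq => op0.
have := pauli_mxtrM id_pauli id_pauli.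
by rewrite eqxx muln1 => <-; rewrite pauli_mx_id op0 mul0mx mxtrace0.
Qed.

(** Paulis span all operators, so identities between channels need checking on them only. *)
Lemma pauli_ext (F G : {linear op R n -> op R n}) :
  (forall b, F (P b) = G (P b)) -> F =1 G.
Proof.
move=> FG A.
suff e (H : {linear op R n -> op R n}) : H A =
    (2 ^ n)%:R^-1 *: \sum_c \tr (P c *m A) *: H (P c).
  by rewrite !e; congr (_ *: _); apply: eq_bigr => c _; rewrite FG.
rewrite -[X in H X](scalerK pow2_neq0) -pauli_complete linearZ linear_sum /=.
by congr (_ *: _); apply: eq_bigr => c _; rewrite linearZ.
Qed.

Lemma anticomm_sign a b :
  (-1) ^+ anticomm R a b = \prod_k (-1) ^+ anticomm1 (a k) (b k) :> R.
Proof.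
pose p := \big[addb/false]_k anticomm1 (a k) (b k).
(* Needed over [R] for the claim and over [R[i]] for the matrices. *)
have signE (S : pzRingType) :
    \prod_k (-1) ^+ anticomm1 (a k) (b k) = (-1) ^+ p :> S.
  by apply/esym/(big_morph (fun x : bool => (-1) ^+ x : S)); [exact: signr_addb|].
have comm : P a *m P b = (-1) ^+ p *: (P b *m P a).
  rewrite -signE !tensorM -tensorZ; apply: eq_tensor => k.
  exact: pauli1_mulC.
rewrite signE; congr (_ ^+ nat_of_bool _).
rewrite /anticomm /comm_mxb comm; case: (p) => /=.
  rewrite expr1 scaleN1r eq_sym -subr_eq0 opprK -mulr2n -scaler_nat scaler_eq0.
  rewrite pnatr_eq0 /=; apply/eqP => ba0.
  (* Commuting and anticommuting at once would give a zero product of invertible matrices. *)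
  case/eqP: op1_neq0; rewrite -(pauli_sqr b) -(mulmx1 (P b)) -(pauli_sqr a).
  by rewrite !mulmxA ba0 !mul0mx.
by rewrite expr0 scale1r eqxx.
Qed.

Lemma pauli_mulC a b :
  P a *m P b = ((-1) ^+ anticomm R a b)%:C *: (P b *m P a).
Proof.
rewrite anticomm_sign rmorph_prod !tensorM -tensorZ; apply: eq_tensor => k.
by rewrite rmorphXn rmorphN1; exact: pauli1_mulC.
Qed.

Lemma anticommC a b : anticomm R a b = anticomm R b a.
Proof. by rewrite /anticomm /comm_mxb eq_sym. Qed.

Lemma anticomm_id a : anticomm R a id_pauli = false.
Proof. by rewrite /anticomm /comm_mxb pauli_mx_id mul1mx mulmx1 eqxx. Qed.

(** Orthogonality of the characters of the Pauli group modulo its center; the sum factorizes over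
    the qubits. *)
Lemma anticomm_orthogonal a c :
  \sum_b (-1) ^+ anticomm R a b * (-1) ^+ anticomm R c b =
    (4 ^ n * (a == c))%:R :> R.
Proof.
under eq_bigr do rewrite !anticomm_sign -big_split /=.
rewrite -(bigA_distr_bigA (fun k s =>
  (-1) ^+ anticomm1 (a k) s * (-1) ^+ anticomm1 (c k) s : R)).
have site s t : \sum_u (-1) ^+ anticomm1 s u * (-1) ^+ anticomm1 t u =
    (4 * (s == t))%:R :> R.
  by rewrite sum_pauli1; case: s; case: t; rewrite /= /anticomm1 /=; ring.
under eq_bigr do rewrite site.
have [<-|aNc] := eqVneq a c.
  under eq_bigr do rewrite eqxx.
  by rewrite prodr_const card_ord !muln1 natrX.
have [k ak] := ffun_neq aNc.
by rewrite (bigD1 k) //= (negPf ak) !muln0 mul0r.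
Qed.

End PauliBasis.

(** * Pauli channels and Clifford gates *)

Section Channels.
Context (R : realType) (n : nat).
Implicit Types (a b c : pauli n) (A : op R n) (f g : pauli n -> R).
Local Notation P := (@pauli_mx R n).
Local Notation id_pauli := ([ffun=> PI] : pauli n).

(** The map diagonal in the Pauli basis with eigenvalues [f]. It covers Pauli channels as well as
    the gauge map, which need not be a channel. *)
Definition multiplier f A : op R n :=
  \sum_c ((f c)%:C * (2 ^ n)%:R^-1 * \tr (P c *m A)) *: P c.

Fact multiplier_is_linear f : linear (multiplier f).
Proof.
move=> x A B; rewrite /multiplier scaler_sumr -big_split; apply: eq_bigr => c _ /=.
by rewrite mulmxDr -scalemxAr mxtraceD mxtraceZ mulrDr scalerDl scalerA mulrCA.
Qed.
HB.instance Definition _ f :=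
  GRing.isLinear.Build R[i] (op R n) (op R n) _ (multiplier f)
    (multiplier_is_linear f).

Lemma multiplierP f b : multiplier f (P b) = (f b)%:C *: P b.
Proof.
rewrite /multiplier (bigD1 b) //= pauli_mxtrM eqxx muln1 mulfVK ?pow2_neq0 //.
rewrite big1 ?addr0 // => c cNb.
by rewrite pauli_mxtrM (negPf cNb) muln0 mulr0 scale0r.
Qed.

Lemma multiplier_comp f g A :
  multiplier f (multiplier g A) = multiplier (fun b => f b * g b) A.
Proof.
apply: (pauli_ext (F := multiplier f \o multiplier g)) => b.
by rewrite /= !multiplierP linearZ /= multiplierP scalerA rmorphM mulrC.
Qed.

Lemma eq_multiplier f g : f =1 g -> multiplier f =1 multiplier g.
Proof. by move=> fg A; apply: eq_bigr => c _; rewrite fg. Qed.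

Fact channel_map_is_linear (L : pauli_channel R n) : linear (channel_map L).
Proof.
move=> x A B; rewrite /channel_map scaler_sumr -big_split; apply: eq_bigr => c _ /=.
by rewrite mulmxDr mulmxDl -scalemxAr -scalemxAl scalerDr !scalerA mulrC.
Qed.
HB.instance Definition _ (L : pauli_channel R n) :=
  GRing.isLinear.Build R[i] (op R n) (op R n) _ (channel_map L)
    (channel_map_is_linear L).

Lemma channel_map_multiplier (L : pauli_channel R n) :
  channel_map L =1 multiplier (fidelity L).
Proof.
apply: pauli_ext => b; rewrite /= multiplierP /channel_map.
rewrite rmorph_sum scaler_suml; apply: eq_bigr => a _.
rewrite pauli_mulC -scalemxAl -mulmxA pauli_sqr mulmx1 scalerA.
by rewrite -rmorphM mulrC.
Qed.

Fact unitary_channel_is_linear (U : op R n) : linear (unitary_channel U).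
Proof.
move=> x A B; rewrite /unitary_channel mulmxDr mulmxDl.
by rewrite -scalemxAr -scalemxAl.
Qed.
HB.instance Definition _ (U : op R n) :=
  GRing.isLinear.Build R[i] (op R n) (op R n) _ (unitary_channel U)
    (unitary_channel_is_linear U).

(* Conjugation by a local unitary mixes only Paulis of equal pattern, so
   it commutes with every multiplier that depends on the pattern alone. *)
Lemma local_pattern_multiplier (V : 'I_n -> 'M[R[i]]_2) (h : pattern n -> R) A :
  (forall k, V k \is unitarymx) ->
  unitary_channel (tensor V) (multiplier (fun b => h (pt b)) A) =
  multiplier (fun b => h (pt b)) (unitary_channel (tensor V) A).
Proof.
move=> Vu; set f := fun b => h (pt b).
apply: (pauli_ext (F := unitary_channel (tensor V) \o multiplier f)
                  (G := multiplier f \o unitary_channel (tensor V))) => b /=.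
rewrite multiplierP linearZ /=; set B := unitary_channel _ _.
rewrite -[in LHS](scalerK (pow2_neq0 R n) B) -pauli_complete !scaler_sumr.
apply: eq_bigr => c _; rewrite !scalerA.
have [cb|cNb] := eqVneq (pt c) (pt b); first by rewrite /f cb.
(* Where the patterns differ, one of the two tensor factors is the identity and the other a
   traceless Pauli, so the trace of that factor vanishes. *)
suff -> : \tr (P c *m B) = 0 by rewrite !mulr0 !scale0r.
have [k ck] := ffun_neq cNb.
rewrite /B /unitary_channel tensor_adj !tensorM tensor_tr (bigD1 k) //=.
suff -> : \tr (pauli1_mx R (c k) *m (V k *m pauli1_mx R (b k) *m (V k)^t*)) = 0.
  by rewrite mul0r.
have /unitarymxP VV := Vu k; have V'V := mulmx1C VV.
move: ck; rewrite !ffunE.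
have [->|cN] := eqVneq (c k) PI; have [->|bN] := eqVneq (b k) PI => // _.
  rewrite pauli1_mxI mul1mx mxtrace_mulC mulmxA V'V -pauli1_mxI.
  by rewrite pauli1_mxtrM eq_sym (negPf bN).
by rewrite pauli1_mxI mulmx1 VV -pauli1_mxI pauli1_mxtrM (negPf cN).
Qed.

(** The image of a Pauli squares to 1, so the phase ['i ^+ k] allowed by [clifford] is a sign and
    the default of [clifford_act] is never taken. *)
Lemma clifford_actP (U : op R n) : clifford U ->
  forall a, exists s : bool,
    unitary_channel U (P a) = (-1) ^+ s *: P (clifford_act U a).
Proof.
move=> [/unitarymxP UU Ucl] a; have U'U := mulmx1C UU.
rewrite /clifford_act; case: pickP => [b /= /orP[/eqP->|/eqP->]|none].
- by exists false; rewrite scale1r.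
- by exists true; rewrite scaleN1r.
have [b [k Ub]] := Ucl a; have := none b; rewrite Ub.
have : unitary_channel U (P a) *m unitary_channel U (P a) = 1%:M.
  rewrite /unitary_channel !mulmxA mulmxKtV //; last exact/unitarymxP.
  by rewrite -(mulmxA U) pauli_sqr mulmx1.
rewrite Ub -scalemxAl -scalemxAr pauli_sqr scalerA -expr2 => /eqP.
rewrite -subr_eq0 -{2}[1%:M]scale1r -scalerBl scaler_eq0 (negPf (op1_neq0 R n)) orbF.
rewrite subr_eq0 sqrf_eq1 => /orP[] /eqP->.
  by rewrite scale1r eqxx.
by rewrite scaleN1r eqxx orbT.
Qed.

Lemma clifford_act_id (U : op R n) :
  clifford U -> clifford_act U id_pauli = id_pauli.
Proof.
move=> Ucl; have [s] := clifford_actP Ucl id_pauli.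
rewrite /unitary_channel {1}pauli_mx_id mulmx1; set b := clifford_act _ _.
have [/unitarymxP -> _] := Ucl => /(congr1 (fun A => \tr (P b *m A))).
rewrite -scalemxAr mxtraceZ -pauli_mx_id !pauli_mxtrM eqxx muln1 => /eqP.
have [//|_] := eqVneq b id_pauli.
by rewrite muln0 eq_sym mulf_eq0 signr_eq0 (negPf (pow2_neq0 R n)).
Qed.

End Channels.

(** * Channels with prescribed small fidelities *)

Section FidelityChannel.
Context (R : realType) (n : nat) (lam : pauli n -> R).
Local Notation id_pauli := ([ffun=> PI] : pauli n).
Context (lam_id : lam id_pauli = 1) (lam_gt0 : forall b, 0 < lam b).
Context (lam_small : \sum_(b | b != id_pauli) lam b < 1).

(** The inverse Walsh-Hadamard transform, recovering error rates from fidelities. *)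
Definition fidelity_rate a : R :=
  (4 ^ n)%:R^-1 * \sum_b (-1) ^+ anticomm R a b * lam b.

Let pow4_neq0 : (4 ^ n)%:R != 0 :> R.
Proof. by rewrite pnatr_eq0 -lt0n expn_gt0. Qed.

Lemma fidelity_rate_gt0 a : 0 < fidelity_rate a.
Proof.
rewrite mulr_gt0 ?invr_gt0 ?ltr0n ?expn_gt0 //.
(* The identity contributes 1, which outweighs all other terms whatever their signs. *)
rewrite (bigD1 id_pauli) //= anticomm_id expr0 mul1r lam_id.
have := lam_small; rewrite -subr_gt0 => small; apply: lt_le_trans small _.
rewrite lerD2l -sumrN; apply: ler_sum => b _.
have := lam_gt0 b.
by case: anticomm; rewrite ?expr0 ?expr1 ?mul1r ?mulN1r; lra.
Qed.

Lemma fidelity_rateK b : \sum_a (-1) ^+ anticomm R a b * fidelity_rate a = lam b.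
Proof.
under eq_bigr do rewrite mulrCA mulr_sumr.
rewrite -mulr_sumr exchange_big /= (bigD1 b) //= [X in _ + X]big1 => [|c cNb].
  have := anticomm_orthogonal R b b; rewrite eqxx muln1 => orth.
  under eq_bigr do rewrite mulrA !(anticommC _ _ b).
  by rewrite -mulr_suml orth addr0 mulKf.
have := anticomm_orthogonal R b c; rewrite eq_sym (negPf cNb) muln0 => orth.
under eq_bigr do rewrite mulrA (anticommC _ _ b) (anticommC _ _ c).
by rewrite -mulr_suml orth mul0r.
Qed.

Lemma fidelity_rate_sum1 : \sum_a fidelity_rate a = 1.
Proof.
rewrite -lam_id -fidelity_rateK; apply: eq_bigr => a _.
by rewrite anticomm_id expr0 mul1r.
Qed.

Definition fidelity_channel : pauli_channel R n :=
  PauliChannel (fun a => ltW (fidelity_rate_gt0 a)) fidelity_rate_sum1.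

Lemma fidelity_channelE b : fidelity fidelity_channel b = lam b.
Proof. exact: fidelity_rateK. Qed.

Lemma fidelity_channel_pos : positive_channel fidelity_channel.
Proof.
by split=> [a|b]; rewrite ?fidelity_channelE //=; exact: fidelity_rate_gt0.
Qed.

End FidelityChannel.

(** * Gauge transformations of noise models *)

Section Gauge.
Context (R : realType) (n : nat) (gate : finType) (U : gate -> op R n).
Context (U_clifford : forall g, clifford (U g)).
Local Notation P := (@pauli_mx R n).
Local Notation id_pauli := ([ffun=> PI] : pauli n).

(* The identity has fidelity 1 in every channel; elsewhere a small factor [t]
   keeps all error rates positive. *)
Definition damped (t : R) (psi : pauli n -> R) (b : pauli n) : R :=
  if b == id_pauli then 1 else t * expR (psi b).

Context (t M : R) (t_gt0 : 0 < t) (t_small : t * ((4 ^ n)%:R * expR M) < 1).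

Lemma damped_id psi : damped t psi id_pauli = 1.
Proof. by rewrite /damped eqxx. Qed.

Lemma damped_gt0 psi b : 0 < damped t psi b.
Proof. by rewrite /damped; case: ifP; rewrite ?ltr01 // mulr_gt0 ?expR_gt0. Qed.

(** At the identity the fidelity is pinned to 1, so only a trivial shift is possible there. *)
Lemma damped_shift psi (chi : R) b : (b = id_pauli -> chi = 0) ->
  damped t psi b * expR chi = damped t (fun b => psi b + chi) b.
Proof.
rewrite /damped; case: eqP => [_ -> //|_ _]; first by rewrite expR0 mulr1.
by rewrite expRD mulrA.
Qed.

Lemma card_pauli : #|{: pauli n}| = (4 ^ n)%N.
Proof.
rewrite card_ffun card_ord; congr (_ ^ _)%N.
by rewrite -sum1_card sum_pauli1.
Qed.

Lemma damped_small psi : (forall b, psi b <= M) ->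
  \sum_(b | b != id_pauli) damped t psi b < 1.
Proof.
move=> psiM; apply: le_lt_trans t_small.
apply: (@le_trans _ _ (\sum_(b : pauli n) t * expR M)); last first.
  by rewrite sumr_const card_pauli -[_ *+ _]mulr_natr -mulrA [expR M * _]mulrC.
rewrite [leRHS](bigD1 id_pauli) //= ler_wpDl ?mulr_ge0 ?expR_ge0 ?(ltW t_gt0) //.
apply: ler_sum => b bN; rewrite /damped (negPf bN).
by rewrite ler_wpM2l ?ler_expR ?(ltW t_gt0).
Qed.

Definition damped_channel psi (psiM : forall b, psi b <= M) : pauli_channel R n :=
  fidelity_channel (damped_id psi) (damped_gt0 psi) (damped_small psiM).

Lemma damped_channelE psi (psiM : forall b, psi b <= M) b :
  fidelity (damped_channel psiM) b = damped t psi b.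
Proof. exact: fidelity_channelE. Qed.

Definition damped_model psiS psiM (psiG : gate -> pauli n -> R)
    (hS : forall b, psiS b <= M) (hM : forall b, psiM b <= M)
    (hG : forall g b, psiG g b <= M) : noise_model R n gate :=
  @NoiseModel R n gate (damped_channel hS) (damped_channel hM)
    (fun g => damped_channel (hG g))
    (fidelity_channel_pos _ _ _) (fidelity_channel_pos _ _ _)
    (fun g => fidelity_channel_pos _ _ _).

Context (phi : pattern n -> R) (phi0 : phi (pt id_pauli) = 0).

(** The coboundary of [phi] on the edge [(b, g)]. *)
Definition gauge_shift g b := phi (pt (clifford_act (U g) b)) - phi (pt b).

Lemma gauge_shift_id g : gauge_shift g id_pauli = 0.
Proof. by rewrite /gauge_shift clifford_act_id // subrr. Qed.

Context (zero_le : 0 <= M) (phi_le : forall b : pauli n, phi (pt b) <= M).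
Context (Nphi_le : forall b : pauli n, - phi (pt b) <= M).
Context (shift_le : forall g b, gauge_shift g b <= M).

Definition plain_model : noise_model R n gate :=
  damped_model (fun=> zero_le) (fun=> zero_le) (fun _ _ => zero_le).
Definition gauged_model : noise_model R n gate :=
  damped_model phi_le Nphi_le shift_le.

Local Notation D := (multiplier (fun b => expR (phi (pt b)))).

(** For a gate, both sides scale [P b] by the damped fidelity with exponent [phi] at the output
    pattern: the gate's shift trades the input value of [phi] for the output value. *)
Lemma gauged_operation x A :
  noisy_operation U gauged_model x (D A) = D (noisy_operation U plain_model x A).
Proof.
case: x => [V Vu|g] /=; first by rewrite (local_pattern_multiplier (expR \o phi)).
rewrite !channel_map_multiplier multiplier_comp.
apply: (pauli_ext (F := unitary_channel (U g) \o multiplier _)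
  (G := D \o (unitary_channel (U g) \o multiplier _))) => b /=.
rewrite !multiplierP !linearZ /=; have [s ->] := clifford_actP (U_clifford g) b.
rewrite !linearZ /= multiplierP !scalerA !damped_channelE.
rewrite -mulrA -rmorphM; congr (_ * _%:C *: _).
rewrite !damped_shift => [|->|->]; rewrite ?clifford_act_id //.
by rewrite /damped add0r subrK.
Qed.

(** The map [D] is created by the preparation, moves through every operation and is cancelled by the
    measurement. *)
Lemma gauged_indistinguishable : indistinguishable U plain_model gauged_model.
Proof.
have prepE A : channel_map (prep_noise gauged_model) A =
    D (channel_map (prep_noise plain_model) A).
  rewrite !channel_map_multiplier multiplier_comp; apply: eq_multiplier => b.
  rewrite !damped_channelE mulrC damped_shift => [|-> //].
  by rewrite /damped add0r.
have measE A : channel_map (meas_noise gauged_model) (D A) =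
    channel_map (meas_noise plain_model) A.
  rewrite !channel_map_multiplier multiplier_comp; apply: eq_multiplier => b.
  rewrite !damped_channelE damped_shift => [|-> //].
  by rewrite /damped addNr.
have circuitE s A : noisy_circuit U gauged_model s (D A) =
    D (noisy_circuit U plain_model s A).
  by elim: s A => //= x s IHs A; rewrite gauged_operation IHs.
by move=> e o; rewrite /outcome_prob prepE circuitE measE.
Qed.

Lemma gauged_log_fidelity a g :
  log_fidelity gauged_model a g = log_fidelity plain_model a g + gauge_shift g a.
Proof.
rewrite /log_fidelity !damped_channelE /damped.
case: eqP => [->|_]; first by rewrite gauge_shift_id addr0.
by rewrite expR0 mulr1 lnM ?posrE ?expR_gt0 // expRK.
Qed.

End Gauge.

(** * Learnable functionals annihilate coboundaries *)

Section LearnableIsCycle.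
Context (R : realType) (n : nat) (gate : finType) (U : gate -> op R n).
Context (U_clifford : forall g, clifford (U g)).
Local Notation G := (pattern_transfer_graph U).
Implicit Types (v : edge_space R G).

Lemma log_functionalE v N :
  log_functional v N = \sum_(e : edge G) v e * log_fidelity N e.1 e.2.
Proof. by rewrite /log_functional pair_bigA; apply: eq_bigr => -[]. Qed.

Lemma gauge_pair (phi : pattern n -> R) : phi (pt [ffun=> PI]) = 0 ->
  exists N1 N2 : noise_model R n gate, indistinguishable U N1 N2 /\
    forall a g, log_fidelity N2 a g = log_fidelity N1 a g + gauge_shift U phi g a.
Proof.
(* [K] bounds every value of [phi], so [K + K] bounds all exponents, including the gate shifts. *)
move=> phi0; pose K := \sum_x `|phi x|.
have phiK x : `|phi x| <= K.
  by rewrite /K (bigD1 x) //= lerDl sumr_ge0.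
have K0 : 0 <= K by rewrite sumr_ge0.
have X0 : 0 < (4 ^ n)%:R * expR (K + K).
  by rewrite mulr_gt0 ?expR_gt0 // ltr0n expn_gt0.
have [t t0 tX] : exists2 t, 0 < t & t * ((4 ^ n)%:R * expR (K + K)) < 1.
  exists (((4 ^ n)%:R * expR (K + K) + 1)^-1); first by rewrite invr_gt0 addr_gt0.
  by rewrite mulrC ltr_pdivrMr ?addr_gt0 // mul1r ltrDl.
have [phiP phiN] : (forall x, phi x <= K) /\ (forall x, - phi x <= K).
  by split=> x; apply: le_trans (phiK x); rewrite ?ler_norm // -normrN ler_norm.
have KK0 : 0 <= K + K by rewrite addr_ge0.
have KKP (b : pauli n) : phi (pt b) <= K + K by rewrite ler_wpDr.
have KKN (b : pauli n) : - phi (pt b) <= K + K by rewrite ler_wpDr.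
have KKg g b : gauge_shift U phi g b <= K + K by rewrite lerD.
exists (plain_model gate t0 tX KK0), (gauged_model t0 tX KKP KKN KKg); split.
  exact: gauged_indistinguishable.
exact: gauged_log_fidelity.
Qed.

Lemma learnable_ker_boundary v :
  learnable U (log_functional v) -> v \in lker (boundary R G).
Proof.
move=> learn; apply/mem_ker_boundary => f.
(* Normalized to vanish at the identity pattern; the constant drops out of the coboundary. *)
pose phi x := f x - f (pt [ffun=> PI]).
have [N1 [N2 [indist logE]]] := gauge_pair (subrr _ : phi (pt [ffun=> PI]) = 0).
have [eqf|/eqP/learn//] := eqVneq (log_functional v N1) (log_functional v N2).
apply: (addrI (log_functional v N1)); rewrite addr0 {2}eqf !log_functionalE.
rewrite -big_split; apply: eq_bigr => -[a g] _.
rewrite coboundaryE /= -mulrDr; congr (_ * _); rewrite logE; congr (_ + _).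
by rewrite /gauge_shift /phi /= opprB addrA subrK.
Qed.

End LearnableIsCycle.

(** * Experiments with Pauli states and measurements *)

Section PauliExperiments.
Context (R : realType) (n : nat).
Implicit Types (b : pauli n) (A : op R n).
Local Notation P := (@pauli_mx R n).
Local Notation id_pauli := ([ffun=> PI] : pauli n).

Lemma psd_gram (c : R[i]) A : 0 <= c -> psd (c *: (A *m A^t*)).
Proof.
move=> c0 x; rewrite -scalemxAr -scalemxAl mxE mulr_ge0 //.
have -> : x^t* *m (A *m A^t*) *m x = (A^t* *m x)^t* *m (A^t* *m x).
  by rewrite trmx_mul map_mxM trmxCK !mulmxA.
by rewrite mxE sumr_ge0 // => k _; rewrite !mxE mulrC mul_conjC_ge0.
Qed.

(** [Q] is Hermitian with [Q *m Q = 2 *: Q], so it is half of a Gram matrix. *)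
Lemma psd_pauli (c : R[i]) (s : bool) b :
  0 <= c -> psd (c *: (1%:M + (-1) ^+ s *: P b)).
Proof.
move=> c0; set Q := 1%:M + _.
have Qadj : Q^t* = Q.
  rewrite /Q linearD linearZ /= map_mxD map_mxZ trmx1 map_mx1 pauli_adj.
  by rewrite rmorphXn rmorphN1.
have QQ : Q *m Q^t* = 2 *: Q.
  rewrite Qadj /Q mulmxDl mul1mx mulmxDr mulmx1 -scalemxAl -scalemxAr scalerA.
  rewrite pauli_sqr -expr2 sqrr_sign scale1r [X in _ + X]addrC.
  by rewrite -mulr2n -[_ *+ 2]scaler_nat.
have -> : c *: Q = (c / 2) *: (Q *m Q^t*).
  by rewrite QQ scalerA divfK ?pnatr_eq0.
by apply: psd_gram; rewrite mulr_ge0 // invr_ge0 ler0n.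
Qed.

(* The factor 1 + (b == id) covers the identity, where 1 + P_b = 2. *)
Definition pauli_state b : op R n :=
  ((2 ^ n)%:R * (1 + (b == id_pauli)%:R))^-1 *: (1%:M + P b).

Lemma pauli_state_norm_gt0 b :
  0 < (2 ^ n)%:R * (1 + (b == id_pauli)%:R) :> R[i].
Proof. by rewrite mulr_gt0 ?ltr0n ?expn_gt0 // ltr_wpDr ?ler0n ?ltr01. Qed.

Lemma pauli_state_density b : density (pauli_state b).
Proof.
have norm_gt0 := pauli_state_norm_gt0 b; split.
  rewrite /pauli_state -[P b]scale1r; apply: (@psd_pauli _ false).
  by rewrite invr_ge0 ltW.
rewrite mxtraceZ mxtraceD -[1%:M]mul1mx -[P b]mul1mx -pauli_mx_id !pauli_mxtrM.
rewrite eqxx muln1 natrM -{2}[(2 ^ n)%:R]mulr1 -mulrDr [id_pauli == b]eq_sym.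
by rewrite mulVf // gt_eqF.
Qed.

Lemma pauli_from_states b : exists x y : R[i],
  P b = x *: pauli_state b + y *: pauli_state id_pauli.
Proof.
pose x c : R[i] := (2 ^ n)%:R * (1 + (c == id_pauli)%:R).
have stateK c : x c *: pauli_state c = 1%:M + P c.
  by rewrite scalerKV // gt_eqF // pauli_state_norm_gt0.
(* Rescaling gives [1 + P b]; the state of the identity label, rescaled to [2 * 1] and halved,
   removes the 1. *)
exists (x b), (- (x id_pauli / 2)); rewrite stateK scaleNr [x id_pauli / 2]mulrC.
rewrite -scalerA stateK pauli_mx_id -mulr2n -[1%:M *+ 2]scaler_nat scalerA.
by rewrite mulVf ?pnatr_eq0 // scale1r addrC addKr.
Qed.

Definition pauli_effect b (o : bool) : op R n :=
  2^-1 *: (1%:M + (-1) ^+ o *: P b).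

Lemma pauli_effect_povm b : povm (pauli_effect b).
Proof.
split=> [o|]; first by apply: psd_pauli; rewrite invr_ge0 ler0n.
rewrite big_bool /= /pauli_effect -scalerDr expr1 expr0 scale1r scaleN1r.
rewrite addrACA addNr addr0 -mulr2n -[1%:M *+ 2]scaler_nat scalerA.
by rewrite mulVf ?pnatr_eq0 // scale1r.
Qed.

Lemma pauli_effect_diff b : pauli_effect b false - pauli_effect b true = P b.
Proof.
rewrite /pauli_effect -scalerBr expr1 expr0 scale1r scaleN1r.
rewrite opprD opprK addrACA subrr add0r -mulr2n -[P b *+ 2]scaler_nat scalerA.
by rewrite mulVf ?pnatr_eq0 // scale1r.
Qed.

End PauliExperiments.

(** * Cycles are learnable from one-step Pauli experiments *)

Section CycleIsLearnable.
Context (R : realType) (n : nat) (gate : finType) (U : gate -> op R n).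
Context (U_clifford : forall g, clifford (U g)).
Implicit Types (N : noise_model R n gate) (s : seq (operation R n gate)).
Local Notation P := (@pauli_mx R n).
Local Notation id_pauli := ([ffun=> PI] : pauli n).
Local Notation G := (pattern_transfer_graph U).

Fact noisy_operation_is_linear N x : linear (noisy_operation U N x).
Proof.
case: x => [V Vu|g] z A B /=; first exact: unitary_channel_is_linear.
by rewrite channel_map_is_linear unitary_channel_is_linear.
Qed.

Fact noisy_circuit_is_linear N s : linear (noisy_circuit U N s).
Proof.
by elim: s => [|x s IHs] z A B //=; rewrite noisy_operation_is_linear IHs.
Qed.
HB.instance Definition _ N s :=
  GRing.isLinear.Build R[i] (op R n) (op R n) _ (noisy_circuit U N s)
    (noisy_circuit_is_linear N s).

(** Defined for every operator [A], not only for states, so that a bare Pauli can be inserted by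
    linearity. *)
Definition expectation N s (b : pauli n) (A : op R n) : R[i] :=
  \tr (P b *m channel_map (meas_noise N)
                (noisy_circuit U N s (channel_map (prep_noise N) A))).

Fact expectation_is_linear N s b : scalar (expectation N s b).
Proof.
move=> x A B; rewrite /expectation channel_map_is_linear noisy_circuit_is_linear.
by rewrite channel_map_is_linear mulmxDr -scalemxAr mxtraceD mxtraceZ.
Qed.
HB.instance Definition _ N s b :=
  GRing.isLinear.Build R[i] (op R n) R[i] _ (expectation N s b)
    (expectation_is_linear N s b).

Lemma expectation_local N (b b' : pauli n) V
    (Vu : forall k, V k \is unitarymx) :
  unitary_channel (tensor V) (P b) = P b' ->
  expectation N [:: Local1 gate Vu] b' (P b) =
    (fidelity (prep_noise N) b * fidelity (meas_noise N) b')%:C * (2 ^ n)%:R.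
Proof.
move=> VP; rewrite /expectation /= !channel_map_multiplier multiplierP.
rewrite linearZ /= VP linearZ /= multiplierP scalerA -scalemxAr mxtraceZ.
by rewrite pauli_mxtrM eqxx muln1 rmorphM.
Qed.

Lemma expectation_gate N g (sgn : bool) (b b' : pauli n) :
  unitary_channel (U g) (P b) = (-1) ^+ sgn *: P b' ->
  expectation N [:: Gate R n g] b' (P b) =
    (fidelity (prep_noise N) b * fidelity (gate_noise N g) b
     * fidelity (meas_noise N) b')%:C * ((-1) ^+ sgn * (2 ^ n)%:R).
Proof.
move=> UP; rewrite /expectation /= !channel_map_multiplier multiplierP.
rewrite linearZ /= multiplierP !linearZ /= UP !linearZ /= multiplierP.
by rewrite !linearZ /= pauli_mxtrM eqxx muln1 !rmorphM /=; ring.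
Qed.

Section Indistinguishable.
Context (N1 N2 : noise_model R n gate).
Context (indist : indistinguishable U N1 N2).

(** On Pauli states the expectation is a difference of two outcome probabilities; linearity carries
    the equality to [P b]. *)
Lemma expectation_eq s (b b' : pauli n) :
  expectation N1 s b' (P b) = expectation N2 s b' (P b).
Proof.
have stateE c : expectation N1 s b' (pauli_state R c) =
    expectation N2 s b' (pauli_state R c).
  pose e := Experiment (pauli_state_density R c) (pauli_effect_povm R b') s.
  have splitE N : expectation N s b' (pauli_state R c) =
      outcome_prob U N (e := e) false - outcome_prob U N (e := e) true.
    by rewrite /expectation -(pauli_effect_diff R b') mulmxBl raddfB.
  by rewrite !splitE !(indist (e := e)).
have [x [y ->]] := pauli_from_states R b.
move: (pauli_state R b) (pauli_state R id_pauli) (stateE b) (stateE id_pauli).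
by move=> A B EA EB; rewrite !linearD !linearZ /= EA EB.
Qed.

Lemma spam_fidelity_eq (b b' : pauli n) : pt b = pt b' ->
  fidelity (prep_noise N1) b * fidelity (meas_noise N1) b' =
  fidelity (prep_noise N2) b * fidelity (meas_noise N2) b'.
Proof.
move=> /ffunP bb'.
(* Equal patterns let each qubit be rotated separately. *)
have /fin_all_exists2[V Vu VP] k : exists2 V : 'M[R[i]]_2, V \is unitarymx &
    V *m pauli1_mx R (b k) *m V^t* = pauli1_mx R (b' k).
  by apply: pauli1_rotation; have := bb' k; rewrite !ffunE.
have VPb : unitary_channel (tensor V) (P b) = P b'.
  by rewrite /unitary_channel tensor_adj !tensorM; exact: eq_tensor.
have := expectation_eq [:: Local1 gate Vu] b b'.
rewrite !(expectation_local _ Vu VPb) => /(mulIf (pow2_neq0 R n)).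
exact: complexI.
Qed.

(** The sign produced by the gate is the same in both models and cancels. *)
Lemma gate_fidelity_eq g (b : pauli n) :
  let b' := clifford_act (U g) b in
  fidelity (prep_noise N1) b * fidelity (gate_noise N1 g) b
    * fidelity (meas_noise N1) b' =
  fidelity (prep_noise N2) b * fidelity (gate_noise N2 g) b
    * fidelity (meas_noise N2) b'.
Proof.
have [sgn UP] := clifford_actP (U_clifford g) b.
have := expectation_eq [:: Gate R n g] b (clifford_act (U g) b).
rewrite !(expectation_gate _ UP) => /mulIf.
by rewrite mulf_neq0 ?signr_eq0 ?pow2_neq0 // => /(_ isT); exact: complexI.
Qed.

Lemma log_fidelity_gradient : exists f : {ffun pattern n -> R^o},
  forall a g, log_fidelity N1 a g - log_fidelity N2 a g =
    f (pt (clifford_act (U g) a)) - f (pt a).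
Proof.
pose sigma b := ln (fidelity (prep_noise N1) b) - ln (fidelity (prep_noise N2) b).
pose mu b := ln (fidelity (meas_noise N1) b) - ln (fidelity (meas_noise N2) b).
have S0 N b : fidelity (prep_noise N) b \is Num.pos.
  by rewrite posrE; exact: (prep_noise_pos N).2.
have M0 N b : fidelity (meas_noise N) b \is Num.pos.
  by rewrite posrE; exact: (meas_noise_pos N).2.
have G0 N g b : fidelity (gate_noise N g) b \is Num.pos.
  by rewrite posrE; exact: (gate_noise_pos N g).2.
have spam b b' : pt b = pt b' -> sigma b = - mu b'.
  move/spam_fidelity_eq/(congr1 (@ln R)); rewrite !lnM // /sigma /mu; lra.
(* Any Pauli of the given pattern would do, since [sigma] turns out to depend on the pattern
   only. *)
pose rep (x : pattern n) : pauli n := [ffun k => if x k then PX else PI].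
have ptK x : pt (rep x) = x.
  by apply/ffunP => k; rewrite !ffunE; case: (x k).
(* Preparation and measurement differences cancel on the same Pauli; comparing two Paulis of one
   pattern then equates their [sigma]. *)
have muE b : mu b = - sigma b by rewrite (spam b b) ?opprK.
have sigmaE b : sigma (rep (pt b)) = sigma b by rewrite (spam _ b) ?muE ?opprK.
exists [ffun x => sigma (rep x)] => a g; rewrite !ffunE !sigmaE.
have := muE (clifford_act (U g) a); rewrite /mu.
have := congr1 (@ln R) (gate_fidelity_eq g a); rewrite /= !lnM ?rpredM //.
rewrite /log_fidelity /sigma => eq1 eq2; move: eq1 eq2.
move: (clifford_act (U g) a) => b.
(* With the eight logarithms made atoms, the claim is linear. *)
by do 8 (move: (ln _) => ?); lra.
Qed.

End Indistinguishable.

Lemma ker_boundary_learnable (v : edge_space R G) :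
  v \in lker (boundary R G) -> learnable U (log_functional v).
Proof.
move=> /mem_ker_boundary vker N1 N2 fN indist; apply: fN.
have [f fE] := log_fidelity_gradient indist.
apply/eqP; rewrite -subr_eq0 !log_functionalE -sumrB; apply/eqP.
(* The difference of the two functional values is the pairing of [v] with a coboundary. *)
apply: etrans (vker f); apply: eq_bigr => -[a g] _.
by rewrite coboundaryE /= -mulrBr fE.
Qed.

End CycleIsLearnable.

Theorem theorem2 (R : realType) (n : nat) (n_gt0 : (0 < n)%N)
    (gate : finType) (U : gate -> op R n)
    (U_clifford : forall g, clifford (U g))
    (U_distinct : forall g h, unitary_channel (U g) =1 unitary_channel (U h) -> g = h) :
  let G := pattern_transfer_graph U in
  (forall v : edge_space R G, learnable U (log_functional v) <-> cycle_space v) /\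
  exists F_L : {vspace edge_space R G},
    [/\ forall v, v \in F_L <-> learnable U (log_functional v),
        forall u, (forall v, v \in F_L -> dot u v = 0) <-> cut_space u
      & (#|gate| * 4 ^ n)%N%:Z - (\dim F_L)%:Z = (2 ^ n)%N%:Z - (nb_components G)%:Z].
Proof.
move=> G.
have learnE (v : edge_space R G) :
    learnable U (log_functional v) <-> v \in lker (boundary R G).
  split; [exact: learnable_ker_boundary | exact: ker_boundary_learnable].
split=> [v|]; first by rewrite learnE cycle_spaceE.
exists (lker (boundary R G)); split=> [v|u|].
- by rewrite learnE.
- exact: orthogonal_ker_boundary.
(* The count becomes the cyclomatic number formula, taken in the integers to avoid truncated
   subtraction. *)
have := cyclomatic_number R G.
have -> : #|vertex G| = (2 ^ n)%N by rewrite card_ffun card_bool card_ord.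
have -> : #|edge G| = (#|gate| * 4 ^ n)%N by rewrite card_prod card_pauli mulnC.
move/(congr1 Posz); rewrite !PoszD => eqD; apply/eqP.
by rewrite subr_eq addrAC [_ + (\dim _)%:Z]addrC eqD addrK.
Qed.
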